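(* Let $\mathcal{G}=(\mathcal{V},\mathcal{E})$ be a graph with $E=|\mathcal{E}|$ edges, and let $\epsilon>0$ and $\gamma\in(0,1)$. Consider the algorithm which, on input $w:\mathcal{E}\to\mathbb{R}^+$, samples independently for each edge $e$ a random variable $X_e\sim\mathrm{Lap}(1/\epsilon)$, sets $w'(e)=w(e)+X_e+(1/\epsilon)\ln(E/\gamma)$, outputs $w'$, and for each pair of vertices $x,y$ takes as the released path between $x$ and $y$ a minimum-weight path from $x$ to $y$ in $(\mathcal{G},w')$. This algorithm is $\epsilon$-differentially private on $\mathcal{G}$, and with probability at least $1-\gamma$, simultaneously for all pairs of vertices $s,t\in\mathcal{V}$: if there exists a path from $s$ to $t$ with $k$ edges and $w$-weight $W$, then the released path from $s$ to $t$ has $w$-weight at most $W+(2k/\epsilon)\ln(E/\gamma)$.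
   Context: Private edge weight model: for a graph $\mathcal{G}=(\mathcal{V},\mathcal{E})$, a weight function is $w:\mathcal{E}\to\mathbb{R}^+$ (nonnegative reals). Two weight functions $w,w'$ are neighboring if $\sum_{e\in\mathcal{E}}|w(e)-w'(e)|\le 1$. A randomized algorithm $\mathcal{A}$ on weight functions is $\epsilon$-differentially private on $\mathcal{G}$ if for all neighboring $w,w'$ and all sets $S$ of outputs, $\Pr[\mathcal{A}(w)\in S]\le e^{\epsilon}\Pr[\mathcal{A}(w')\in S]$. $\mathrm{Lap}(b)$ is the Laplace distribution with density $\frac{1}{2b}e^{-|x|/b}$. The weight of a path under a weight function is the sum of the weights of its edges. *)

(* Defs.v *)
From HB Require Import structures.
From mathcomp Require Import all_boot all_order all_algebra.
From mathcomp Require Import all_classical all_reals all_analysis.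
Set Implicit Arguments. Unset Strict Implicit. Unset Printing Implicit Defensive.
Import Order.TTheory GRing.Theory Num.Theory.
Local Open Scope classical_set_scope.
Local Open Scope ring_scope.

(* An (undirected, possibly multi-) graph G = (V, E) is given by a finite
   vertex type V, a finite edge type E and the endpoints [ends e] of each edge. *)
Definition edge_joins (V E : finType) (ends : E -> V * V) (e : E) (x y : V) : bool :=
  (ends e == (x, y)) || (ends e == (y, x)).

Definition is_path (V E : finType) (ends : E -> V * V) (s t : V) (p : seq E) : Prop :=
  exists vs : seq V,
    [/\ size vs = (size p).+1, head s vs = s, last s vs = t, uniq vs &
        all (fun ev => edge_joins ends ev.1 ev.2.1 ev.2.2)
            (zip p (zip vs (behead vs)))].

Definition path_weight (R : realType) (E : finType) (w : E -> R) (p : seq E) : R :=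
  \sum_(e <- p) w e.

Definition nonneg_weight (R : realType) (E : finType) (w : E -> R) : Prop :=
  forall e, 0 <= w e.

Definition neighboring (R : realType) (E : finType) (w w' : E -> R) : Prop :=
  \sum_(e : E) `|w e - w' e| <= 1.

Definition min_path_selector (R : realType) (V E : finType) (ends : E -> V * V)
    (sel : (E -> R) -> V -> V -> seq E) : Prop :=
  forall (v : E -> R) (x y : V),
    (exists p, is_path ends x y p) ->
    is_path ends x y (sel v x y) /\
    forall p, is_path ends x y p -> path_weight v (sel v x y) <= path_weight v p.

Definition laplace_pdf (R : realType) (b : R) (x : R) : R :=
  (2 * b)^-1 * expR (- (`|x| / b)).

Definition laplace_law (R : realType) (b : R) (B : set R) : \bar R :=
  (\int[@lebesgue_measure R]_(x in B) (laplace_pdf b x)%:E)%E.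

Definition iid_laplace (R : realType) (E : finType) (d : measure_display)
    (Omega : measurableType d) (P : probability Omega R) (b : R)
    (X : E -> Omega -> R) : Prop :=
  (forall e, measurable_fun setT (X e)) /\
  forall B : E -> set R, (forall e, measurable (B e)) ->
    P (\bigcap_(e in setT) (X e @^-1` B e)) = (\prod_(e : E) laplace_law b (B e))%E.

Definition edge_rects (R : realType) (E : finType) : set (set (E -> R)) :=
  [set \bigcap_(e in setT) ((fun v : E -> R => v e) @^-1` B e) |
     B in [set B : E -> set R | forall e, measurable (B e)]].

Definition borel_weights (R : realType) (E : finType) : set (set (E -> R)) :=
  <<s @edge_rects R E >>.

Definition eps_DP (R : realType) (E : finType) (d : measure_display)
    (Omega : measurableType d) (P : probability Omega R) (O : Type)
    (M : (E -> R) -> Omega -> O) (events : set (set O)) (eps : R) : Prop :=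
  forall w w' : E -> R, nonneg_weight w -> nonneg_weight w' -> neighboring w w' ->
  forall S : set O, events S ->
    (P [set om | S (M w om)] <= (expR eps)%:E * P [set om | S (M w' om)])%E.

Definition noisy_weights (R : realType) (E : finType) (eps gamma : R)
    (X : E -> R) (w : E -> R) : E -> R :=
  fun e => w e + X e + eps^-1 * ln (#|E|%:R / gamma).

Definition mechanism (R : realType) (V E : finType) (d : measure_display)
    (Omega : measurableType d) (sel : (E -> R) -> V -> V -> seq E)
    (eps gamma : R) (X : E -> Omega -> R) (w : E -> R) (om : Omega)
  : (E -> R) * (V -> V -> seq E) :=
  let w' := noisy_weights eps gamma (fun e => X e om) w in (w', sel w').

(* measurable output events: sets of outputs (w', paths) whose membership is
   a Borel condition on w' (the paths being the function sel of w'). *)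
Definition output_events (R : realType) (V E : finType)
    (sel : (E -> R) -> V -> V -> seq E) : set (set ((E -> R) * (V -> V -> seq E))) :=
  [set S | @borel_weights R E [set v | S (v, sel v)]].

(* Main.v *)
Require Import Defs.
From HB Require Import structures.
From mathcomp Require Import all_boot all_order all_algebra.
From mathcomp Require Import all_classical all_reals all_analysis measurable_realfun.
From mathcomp Require Import ring lra.
Import Order.TTheory GRing.Theory Num.Theory.
Import HBNNSimple numFieldTopology.Exports.
Local Open Scope classical_set_scope.
Local Open Scope ring_scope.

(* Privacy: moving from [w'] to [w] translates the noise vector, one coordinate
   at a time.  Translating the coordinate [e] by [a] multiplies the joint law by
   the density [expR ((`|X e| - `|X e - a|) / b)], which is at most
   [expR (`|a| / b)]; the tilted and the translated laws agree on rectangles,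
   hence on all Borel sets, and the factors multiply up to
   [expR (\sum_e `|w e - w' e| / b)].
   Accuracy: by the Laplace tail and a union bound, all [`|X e|] are at most
   [c = eps^-1 * ln (#|E| / gamma)] with probability at least [1 - gamma].  Then
   [w <= noisy w <= w + 2 c] on every edge, so that for any path [p] the released
   path [q] satisfies [w(q) <= noisy(q) <= noisy(p) <= w(p) + 2 c |p|]. *)

(** * Measures given by a density, and change of measure *)

Section density.
Context {d : measure_display} {T : measurableType d} {R : realType}.
Variables (mu : {measure set T -> \bar R}) (f : T -> R).
Local Open Scope ereal_scope.

(* The proofs are arguments so that the measure structure can be inferred. *)
Definition density (mf : measurable_fun setT f) (f0 : forall x, (0 <= f x)%R)
  (A : set T) : \bar R := \int[mu]_(x in A) (f x)%:E.

Hypotheses (mf : measurable_fun setT f) (f0 : forall x, (0 <= f x)%R).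

Let density_set0 : density mf f0 set0 = 0.
Proof. by rewrite /density integral_set0. Qed.

Let density_ge0 A : 0 <= density mf f0 A.
Proof. by apply: integral_ge0 => x _; rewrite lee_fin. Qed.

Let density_sigma_additive : semi_sigma_additive (density mf f0).
Proof.
move=> F mF tF mUF; rewrite /density; apply: cvg_toP.
  apply: ereal_nondecreasing_is_cvgn => m n mn.
  by apply: lee_sum_nneg_natr => // k _ _; exact: density_ge0.
rewrite ge0_integral_bigcup//=.
- exact/measurable_EFinP/measurable_funTS.
- by move=> x _; rewrite lee_fin.
Qed.

HB.instance Definition _ := isMeasure.Build _ _ _ (density mf f0)
  density_set0 density_ge0 density_sigma_additive.

Let integral_density_nnsfun (D : set T) (h : {nnsfun T >-> R}) :
  measurable D ->
  \int[density mf f0]_(x in D) (h x)%:E = \int[mu]_(x in D) (h x * f x)%:E.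
Proof.
move=> mD.
under [LHS]eq_integral do rewrite fimfunE -fsumEFin//.
rewrite [LHS]ge0_integral_fsum//; last 2 first.
  - by move=> r; exact/measurable_EFinP/measurableT_comp.
  - by move=> r x _; rewrite EFinM nnfun_muleindic_ge0.
under [RHS]eq_integral.
  move=> x xD; rewrite EFinM fimfunE -fsumEFin// ge0_mule_fsuml; last first.
    by move=> r; rewrite EFinM nnfun_muleindic_ge0.
  over.
rewrite [RHS]ge0_integral_fsum//; last 2 first.
  - move=> r; apply: emeasurable_funM; apply/measurable_EFinP.
      by do 2 apply/measurableT_comp => //.
    exact: measurable_funTS.
  - by move=> r x _; rewrite mule_ge0 ?lee_fin// -lee_fin EFinM nnfun_muleindic_ge0.
apply: eq_fsbigr => r _; rewrite integralZl_indic_nnsfun// integral_indic//.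
rewrite /= /density setIC integral_mkcondr.
(* For [r < 0] the level set of the nonnegative [h] is empty and both sides vanish; for [r >= 0] the
   constant can be pulled out of the integral. *)
have [r0|r0] := ltP r 0%R.
  rewrite preimage_nnfun0// indic0.
  rewrite [RHS]integral0_eq ?integral0_eq ?mule0//.
    by move=> x _; rewrite patchE in_set0.
  by move=> x _; rewrite mulr0 mul0e.
rewrite -ge0_integralZl//; last 2 first.
  - have mE : measurable (h @^-1` [set r]) by [].
    apply: (iffLR (measurable_restrict _ mE mD)).
    exact/measurable_EFinP/measurable_funTS.
  - by move=> x _; apply: erestrict_ge0 => y _; rewrite lee_fin.
by apply: eq_integral => x _; rewrite epatch_indic EFinM -muleA [X in _ = _ * X]muleC.
Qed.

(** Linearity gives the case of simple functions; monotone convergence along [nnsfun_approx] extends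
    it to every nonnegative measurable [g]. *)
Lemma integral_density (D : set T) (g : T -> \bar R) :
  measurable D -> measurable_fun D g -> (forall x, D x -> 0 <= g x) ->
  \int[density mf f0]_(x in D) g x = \int[mu]_(x in D) (g x * (f x)%:E).
Proof.
move=> mD mg g0; pose g_ := nnsfun_approx mD mg.
transitivity (limn (fun n => \int[density mf f0]_(x in D) (g_ n x)%:E)).
  rewrite -monotone_convergence//=.
  - apply: eq_integral => x /[!inE] xD; apply/esym/cvg_lim => //=.
    exact: cvg_nnsfun_approx.
  - by move=> n; apply: measurableT_comp => //; exact: measurable_funTS.
  - by move=> n x _; rewrite lee_fin.
  - by move=> x _ a b ab; rewrite lee_fin//; exact/lefP/nd_nnsfun_approx.
under eq_fun do rewrite integral_density_nnsfun//.
rewrite -monotone_convergence//=.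
- apply: eq_integral => x /[!inE] xD; apply/cvg_lim => //=.
  under eq_fun do rewrite EFinM.
  by apply: cvgeZr => //; exact: cvg_nnsfun_approx.
- move=> n; apply/measurable_EFinP/measurable_funM; exact: measurable_funTS.
- by move=> n x _; rewrite lee_fin mulr_ge0.
- move=> x _ a b ab; rewrite lee_fin ler_wpM2r//.
  exact/lefP/nd_nnsfun_approx.
Qed.

End density.

(** * The Laplace law: translations and tails *)

Section laplace.
Context {R : realType}.
Notation mu := (@lebesgue_measure R).

(** Translation invariance of Lebesgue measure: its image under [+%R a] gives half-open intervals
    their length, which determines the measure. *)
Lemma ge0_integral_shift (a : R) (B : set R) (f : R -> \bar R) :
  measurable B -> measurable_fun setT f -> (forall x, 0 <= f x)%E ->
  (\int[mu]_(x in +%R a @^-1` B) f x = \int[mu]_(x in B) f (x - a)%R)%E.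
Proof.
move=> mB mf f0.
have ma : measurable_fun [set: measurableTypeR R]
    (+%R a : measurableTypeR R -> measurableTypeR R) by exact: measurable_funD.
pose g (x : R) := f (x - a).
have mg : measurable_fun B g.
  by apply: measurable_funTS; apply: measurableT_comp => //; exact: measurable_funB.
transitivity (\int[pushforward mu (+%R a : _ -> measurableTypeR R)]_(x in B) g x)%E.
  rewrite (ge0_integral_pushforward ma)//; last by move=> y _; exact: f0.
  by apply: eq_integral => x _; rewrite /g /= addrAC subrr add0r.
apply: eq_measure_integral => A mA _; apply/esym.
apply: (lebesgue_measure_unique (mu := pushforward mu _)) => // _ [[c e]] _ <-.
transitivity (mu `]c - a, e - a]%classic).
  rewrite !lebesgue_measure_itv/= !lte_fin ltrD2r.
  by case: ifP => // _; rewrite -!EFinD; congr EFin; ring.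
congr (mu _); apply/seteqP; split => x /=; rewrite !in_itv/=; lra.
Qed.

Lemma laplace_pdf_ge0 (b x : R) : 0 < b -> 0 <= laplace_pdf b x.
Proof. by move=> b0; rewrite mulr_ge0 ?invr_ge0 ?mulr_ge0 ?ltW// expR_gt0. Qed.

Lemma measurable_laplace_pdf (b : R) :
  measurable_fun [set: R] (laplace_pdf b).
Proof.
apply: measurable_funM => //; apply: measurableT_comp => //.
by apply: measurableT_comp => //; apply: measurable_funM => //.
Qed.

Let measurable_EFin_laplace_pdf (b : R) (D : set R) :
  measurable_fun D (fun x => (laplace_pdf b x)%:E).
Proof.
by apply/measurable_EFinP; apply: measurable_funTS; exact: measurable_laplace_pdf.
Qed.

Lemma laplace_pdf_shift (b a x : R) :
  laplace_pdf b (x - a) =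
  expR ((`|x| - `|x - a|) / b) * laplace_pdf b x.
Proof.
rewrite /laplace_pdf mulrCA -expRD; congr (_ * expR _).
by rewrite mulrBl addrAC subrr add0r.
Qed.

Lemma laplace_law_shift (b a : R) (B : set R) : 0 < b -> measurable B ->
  laplace_law b (+%R a @^-1` B) =
  (\int[mu]_(x in B)
    ((expR ((`|x| - `|x - a|) / b))%:E * (laplace_pdf b x)%:E))%E.
Proof.
move=> b0 mB; rewrite /laplace_law ge0_integral_shift//.
  by apply: eq_integral => x _; rewrite laplace_pdf_shift EFinM.
by move=> x; rewrite lee_fin laplace_pdf_ge0.
Qed.

Lemma laplace_law_ge0 (b : R) (B : set R) : 0 < b -> (0 <= laplace_law b B)%E.
Proof.
by move=> b0; apply: integral_ge0 => x _; rewrite lee_fin laplace_pdf_ge0.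
Qed.

(** The density ratio from [laplace_pdf_shift] is bounded on [B] only, so [t] may be negative; the
    tail estimate relies on this. *)
Lemma laplace_law_shift_le (b a t : R) (B : set R) : 0 < b -> measurable B ->
  (forall x, B x -> `|x| - `|x - a| <= t) ->
  (laplace_law b (+%R a @^-1` B) <= (expR (t / b))%:E * laplace_law b B)%E.
Proof.
move=> b0 mB tB; rewrite laplace_law_shift// /laplace_law.
have pdf0 x : (0 <= (laplace_pdf b x)%:E)%E by rewrite lee_fin laplace_pdf_ge0.
rewrite -ge0_integralZl ?lee_fin ?expR_ge0//; last exact: measurable_EFin_laplace_pdf.
apply: ge0_le_integral => //.
- by move=> x _; rewrite mule_ge0// lee_fin expR_ge0.
- apply: emeasurable_funM; last exact: measurable_EFin_laplace_pdf.
  apply/measurable_EFinP.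
  apply: measurableT_comp => //; apply: measurable_funM => //.
  apply: measurable_funB; first exact: measurable_funTS.
  apply: measurableT_comp => //; exact: measurable_funB.
- by apply: emeasurable_funM => //; exact: measurable_EFin_laplace_pdf.
- move=> x Bx; rewrite lee_wpmul2r// lee_fin ler_expR ler_pM2r ?invr_gt0//.
  exact: tB.
Qed.

Lemma set_norm_gt (t : R) :
  [set x : R | t < `|x|] = [set x | x < - t] `|` [set x | t < x].
Proof. by apply/seteqP; split => x /=; rewrite lter_normr ltrNr orbC => /orP. Qed.

(** Each half of the tail is a half-line from the origin moved outward by [t], and there the density
    shrinks by exactly [expR (- t / b)]. The total mass stays as a factor, its value 1 being derived
    later from the product rule. *)
Lemma laplace_law_tail (b t : R) : 0 < b -> 0 <= t ->
  (laplace_law b [set x | (t < `|x|)%R] <=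
   (expR (- t / b))%:E * laplace_law b setT)%E.
Proof.
move=> b0 t0.
have mgt (s : R) : measurable [set x : R | s < x] by rewrite -set_itvoy.
have mlt (s : R) : measurable [set x : R | x < s] by rewrite -set_itvNyo.
have pdf0 x : (0 <= (laplace_pdf b x)%:E)%E by rewrite lee_fin laplace_pdf_ge0.
have lawU (s1 s2 : R) : s1 <= s2 ->
    laplace_law b ([set x | x < s1] `|` [set x | s2 < x]) =
    (laplace_law b [set x | (x < s1)%R] + laplace_law b [set x | (s2 < x)%R])%E.
  move=> s12; apply: ge0_integral_setU => //.
  - exact: mlt.
  - exact: mgt.
  - exact: measurable_EFin_laplace_pdf.
  - apply/disj_setPS => x [/= xs1 s2x]; exfalso; lra.
rewrite set_norm_gt lawU; last by lra.
apply: (@le_trans _ _ ((expR (- t / b))%:E *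
    (laplace_law b [set x | (x < 0)%R] + laplace_law b [set x | (0 < x)%R])))%E.
  rewrite muleDr; last 2 first.
  - by [].
  - by rewrite ge0_adde_def// inE laplace_law_ge0.
  apply: leeD.
  - rewrite (_ : [set x | x < - t] = +%R t @^-1` [set x | x < 0]).
      apply: laplace_law_shift_le => // x /= x0.
      by rewrite !ltr0_norm; lra.
    by apply/seteqP; split => x /= ?; lra.
  - rewrite (_ : [set x | t < x] = +%R (- t) @^-1` [set x | 0 < x]).
      apply: laplace_law_shift_le => // x /= x0.
      by rewrite !gtr0_norm; lra.
    by apply/seteqP; split => x /= ?; lra.
rewrite lee_wpmul2l ?lee_fin ?expR_ge0// -lawU// /laplace_law.
apply: ge0_subset_integral => //.
  by apply: measurableU; [exact: mlt|exact: mgt].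
exact: measurable_EFin_laplace_pdf.
Qed.

End laplace.

(** By independence, the restriction of [P] to [D] has as image under [Y] the Laplace law scaled by
    [P D]; a change of variables gives the formula. It stands in for Fubini's theorem when a single
    coordinate is integrated out. *)
Lemma integral_comp_indep {d : measure_display} {Omega : measurableType d}
    {R : realType} (P : probability Omega R) (Y : Omega -> R) (D : set Omega)
    (b : R) (C : set R) (g : R -> R) :
  0 < b -> measurable_fun setT Y -> measurable D -> measurable C ->
  (forall B, measurable B -> P (D `&` Y @^-1` B) = (P D * laplace_law b B)%E) ->
  measurable_fun setT g -> (forall x, 0 <= g x) ->
  (\int[P]_(om in D `&` Y @^-1` C) (g (Y om))%:E =
   P D * \int[@lebesgue_measure R]_(x in C) ((g x)%:E * (laplace_pdf b x)%:E))%E.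
Proof.
move=> b0 mY mD mC indep mg g0.
have mYC : measurable (Y @^-1` C) by rewrite -[X in measurable X]setTI; exact: mY.
have mY' : measurable_fun setT (Y : _ -> measurableTypeR R) by exact: mY.
have m1 : measurable_fun setT (\1_D : Omega -> R) by exact: measurable_indic.
have ind0 om : 0 <= \1_D om :> R by rewrite indicE ler0n.
have mpdf := measurable_laplace_pdf b.
have pdf0 := fun x => laplace_pdf_ge0 b x b0.
have PD0 : 0 <= fine (P D) by exact: fine_ge0.
have mgE : measurable_fun C (fun x : measurableTypeR R => (g x)%:E).
  by apply/measurable_EFinP; exact: measurable_funTS.
(* The density [\1_D] turns the restriction of [P] to [D] into a measure. *)
transitivity (\int[density P (\1_D) m1 ind0]_(om in Y @^-1` C) (g (Y om))%:E)%E.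
  rewrite integral_density//; last 2 first.
  - by apply/measurable_EFinP; apply: measurable_funTS; exact: measurableT_comp.
  - by move=> om _; rewrite lee_fin.
  rewrite setIC integral_mkcondr.
  by apply: eq_integral => om _; rewrite epatch_indic.
transitivity (\int[pushforward (density P (\1_D) m1 ind0)
    (Y : _ -> measurableTypeR R)]_(x in C) (g x)%:E)%E.
  by rewrite (ge0_integral_pushforward mY')// => x _; rewrite lee_fin.
transitivity (\int[mscale (NngNum PD0)
    (density lebesgue_measure (laplace_pdf b) mpdf pdf0)]_(x in C) (g x)%:E)%E.
  apply: eq_measure_integral => A mA _.
  transitivity (P D * laplace_law b A)%E; last first.
    by rewrite /= /mscale /= fineK ?fin_num_measure.
  rewrite -indep//; transitivity (\int[P]_(om in Y @^-1` A) (\1_D om)%:E)%E => //.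
  by rewrite integral_indic// -[X in measurable X]setTI; exact: mY.
rewrite ge0_integral_mscale//=; last by move=> x _; rewrite lee_fin.
rewrite fineK ?fin_num_measure// integral_density//.
by move=> x _; rewrite lee_fin.
Qed.

(** * Independent Laplace noise: marginals, translations, maximal deviation *)

Section iid.
Context {R : realType} {E : finType} {d : measure_display}.
Context {Omega : measurableType d}.
Variables (P : probability Omega R) (b : R) (X : E -> Omega -> R).
Hypotheses (b0 : 0 < b) (hX : iid_laplace P b X).

Let measurable_preimageX (e : E) (B : set R) :
  measurable B -> measurable (X e @^-1` B).
Proof. by move=> mB; rewrite -[X in measurable X]setTI; apply: hX.1. Qed.

Let measurable_rect (A : set E) (B : E -> set R) :
  (forall e, measurable (B e)) ->
  measurable (\bigcap_(e in A) X e @^-1` B e).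
Proof.
move=> mB; apply: fin_bigcap_measurable => // e _; exact: measurable_preimageX.
Qed.

(* Taking full events in the product rule gives [L ^ #|E| = 1] for the total
   mass [L], so no integral has to be computed. *)
Lemma iid_laplace_law_setT (e0 : E) : laplace_law b setT = 1%E.
Proof.
have := hX.2 (fun=> setT) (fun=> measurableT).
rewrite (_ : \bigcap_(e in setT) _ = setT) ?probability_setT; last exact/seteqP.
have := laplace_law_ge0 b setT b0; case: (laplace_law b setT) => [r| |] //.
- rewrite lee_fin => r0; rewrite prodEFin prodr_const => -[] /esym/eqP.
  by rewrite pexpr_eq1// => [/eqP -> //|]; apply/card_gt0P; exists e0.
(* If the mass were [+oo], the product would be [+oo] or 0, according to whether the remaining
   factor is positive or 0; neither equals 1. *)
- rewrite (bigD1 e0)//= => _.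
  have : (0 <= \prod_(i | i != e0) +oo :> \bar R)%E by apply: prode_ge0 => *.
  rewrite le_eqVlt => /predU1P[<-|/gt0_mulye ->] //.
  by rewrite mule0 => -[] /eqP; rewrite oner_eq0.
Qed.

Lemma iid_laplace_marginal (e0 : E) (B : set R) :
  measurable B -> P (X e0 @^-1` B) = laplace_law b B.
Proof.
move=> mB; have mB' e : measurable (if e == e0 then B else setT) by case: ifP.
transitivity (P (\bigcap_(e in setT) (X e @^-1` (if e == e0 then B else setT)))).
  congr (P _); apply/seteqP; split => [om XB e _ /=|om /(_ e0 I)/=].
    by case: eqP => // ->.
  by rewrite eqxx.
rewrite hX.2// (bigD1 e0)//= eqxx big1 ?mule1// => e /negPf ->.
exact: iid_laplace_law_setT.
Qed.

Lemma iid_laplace_indep (e0 : E) (B : E -> set R) (C : set R) :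
  (forall e, measurable (B e)) -> measurable C ->
  let D := \bigcap_(e in [set e | e != e0]) X e @^-1` B e in
  P (D `&` X e0 @^-1` C) = (P D * laplace_law b C)%E.
Proof.
move=> mB mC D.
have rect (A : set R) : measurable A -> P (D `&` X e0 @^-1` A) =
    (laplace_law b A * \prod_(e | e != e0) laplace_law b (B e))%E.
  move=> mA; have mB' e : measurable (if e == e0 then A else B e) by case: ifP.
  transitivity (P (\bigcap_(e in setT) (X e @^-1` (if e == e0 then A else B e)))).
    congr (P _); apply/seteqP; split => [om [DB XA] e _ /=|om XB].
      by case: eqVneq => [->//|ee0]; exact: DB.
    split=> [e /= /negPf ee0|]; first by have := XB e I; rewrite /= ee0.
    by have := XB e0 I; rewrite /= eqxx.
  rewrite hX.2// (bigD1 e0)//= eqxx; congr (_ * _)%E.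
  by apply: eq_bigr => e /negPf ->.
(* Applying [rect] to the full set identifies [P D] with the product over the other edges. *)
rewrite rect// -[in RHS](setIT D) -(preimage_setT (X e0)) rect//.
by rewrite iid_laplace_law_setT// mul1e muleC.
Qed.

(** The weight space with the sigma-algebra generated by rectangles, so that its measurable sets are
    those of [borel_weights]. *)
Let T : measurableType (@edge_rects R E).-sigma :=
  g_sigma_algebraType (@edge_rects R E).

Let translate (u : E -> R) (om : Omega) : T := fun e => X e om + u e.

Let translate_rect (u : E -> R) (B : E -> set R) :
  translate u @^-1` (\bigcap_(e in setT) ((fun v : E -> R => v e) @^-1` B e)) =
  \bigcap_(e in setT) X e @^-1` (+%R (u e) @^-1` B e).
Proof.
by apply/seteqP; split => om XB e _ /=;
  have := XB e I; rewrite /= /translate addrC.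
Qed.

Let measurable_shift (a : R) (B : set R) : measurable B -> measurable (+%R a @^-1` B).
Proof.
move=> mB; rewrite -[X in measurable X]setTI.
have : measurable_fun [set: R] (+%R a) by exact: measurable_funD.
exact.
Qed.

Let measurable_translate (u : E -> R) : measurable_fun setT (translate u).
Proof.
apply: (@measurability _ _ _ T _ _ (@edge_rects R E) erefl) => _ [_ [B mB <-] <-].
rewrite setTI translate_rect; apply: measurable_rect => e.
by apply: measurable_shift; exact: mB.
Qed.

Lemma iid_laplace_translate1 (u u' : E -> R) (e0 : E) (S : set (E -> R)) :
  borel_weights S -> (forall e, e != e0 -> u' e = u e) ->
  (P [set om | S (fun e => X e om + u' e)%R] <=
   (expR (`|u' e0 - u e0| / b))%:E * P [set om | S (fun e => X e om + u e)%R])%E.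
Proof.
move=> mS uu'; set a := u' e0 - u e0.
(* The ratio of the Laplace densities at [x - a] and at [x]. *)
pose rho (x : R) := expR ((`|x| - `|x - a|) / b).
have rho0 x : 0 <= rho x by exact: expR_ge0.
have mrho : measurable_fun setT rho.
  apply: measurableT_comp => //; apply: measurable_funM => //.
  apply: measurable_funB => //.
  apply: measurableT_comp => //; exact: measurable_funB.
have mrhoX : measurable_fun setT (rho \o X e0).
  by apply: measurableT_comp => //; exact: hX.1.
have rhoX0 om : 0 <= (rho \o X e0) om by exact: rho0.
have mpre (v : E -> R) : measurable (translate v @^-1` S).
  by rewrite -[X in measurable X]setTI; exact: measurable_translate.
have tilt : P (translate u' @^-1` S) =
    density P (rho \o X e0) mrhoX rhoX0 (translate u @^-1` S).
  pose m1 := pushforward P (translate u').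
  pose m2 := pushforward (density P (rho \o X e0) mrhoX rhoX0) (translate u).
  change (m1 S = m2 S).
  (* Rectangles are stable under intersection and include the whole space, which has [m1]-mass 1, so
     agreement on rectangles suffices. *)
  rewrite /m1 /m2; apply: (@measure_unique _ _ T (@edge_rects R E) (fun=> setT)) => //.
  - move=> _ _ [B mB <-] [C mC <-]; exists (fun e => B e `&` C e).
      by move=> e; exact: measurableI.
    by rewrite bigcapI.
  - by move=> _; exists (fun=> setT) => //; exact/seteqP.
  - by apply/seteqP; split => // v _; exists 0%N.
  - move=> _ [B mB <-].
    suff : P (\bigcap_(e in setT) X e @^-1` (+%R (u' e) @^-1` B e)) =
        (\int[P]_(om in \bigcap_(e in setT) X e @^-1` (+%R (u e) @^-1` B e))
          (rho (X e0 om))%:E)%E by rewrite -!translate_rect.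
    pose C e := +%R (u e) @^-1` B e.
    have mC e : measurable (C e) by exact: measurable_shift.
    (* [D] gathers the constraints on the edges other than [e0], where [u] and [u'] coincide. Both
       rectangles are [D] cut by one condition on [X e0], which makes the comparison
       one-dimensional. *)
    pose D := \bigcap_(e in [set e | e != e0]) X e @^-1` C e.
    have split_e0 v : (forall e, e != e0 -> v e = u e) ->
        \bigcap_(e in setT) X e @^-1` (+%R (v e) @^-1` B e) =
        D `&` X e0 @^-1` (+%R (v e0) @^-1` B e0).
      move=> vu; apply/seteqP; split => [om XB|om [DB XB] e _].
        by split => [e ee0|]; [rewrite /C -vu//|]; exact: XB.
      by have [->//|ee0] := eqVneq e e0; rewrite vu//; exact: DB.
    rewrite (split_e0 u')// (split_e0 u)//.
    rewrite (integral_comp_indep P (X e0) D b _ rho b0 (hX.1 e0))//; last 3 first.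
    + exact: measurable_rect.
    + exact: mC.
    + by move=> A mA; exact: iid_laplace_indep.
    have -> : +%R (u' e0) @^-1` B e0 = +%R a @^-1` C e0.
      by apply/funext => x; rewrite /C /= addrA subrKC.
    rewrite iid_laplace_indep//; last exact: measurable_shift.
    by rewrite laplace_law_shift.
  - by move=> _; rewrite /= /pushforward preimage_setT probability_setT ltry.
rewrite -/(translate u' @^-1` S) tilt /density.
rewrite -/(translate u @^-1` S) -integral_cst//.
apply: ge0_le_integral => //.
- by move=> om _; rewrite lee_fin.
- by apply/measurable_EFinP; exact: measurable_funTS.
- move=> om _; rewrite lee_fin ler_expR ler_pM2r ?invr_gt0//.
  have := ler_normD (X e0 om - a) a; rewrite subrK; lra.
Qed.

Lemma iid_laplace_translate (u u' : E -> R) (S : set (E -> R)) :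
  borel_weights S ->
  (P [set om | S (fun e => X e om + u' e)%R] <=
   (expR ((\sum_e `|u' e - u e|) / b))%:E *
     P [set om | S (fun e => X e om + u e)%R])%E.
Proof.
(* Hybrid argument: [v s] follows [u'] on [s] and [u] elsewhere, so passing from [s] to [e0 :: s]
   changes one coordinate and costs one exponential factor. *)
move=> mS; pose v (s : seq E) e := if e \in s then u' e else u e.
suff H (s : seq E) : uniq s ->
    (P [set om | S (fun e => X e om + v s e)%R] <=
     (expR ((\sum_(e <- s) `|u' e - u e|) / b))%:E *
       P [set om | S (fun e => X e om + u e)%R])%E.
  have := H _ (enum_uniq E); rewrite big_enum/=.
  suff -> : v (enum E) = u' by [].
  by apply/funext => e; rewrite /v mem_enum.
elim: s => [_|e0 s IH /= /andP[e0s /IH{}IH]].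
  by rewrite big_nil mul0r expR0 mul1e.
apply: (le_trans (iid_laplace_translate1 (v s) (v (e0 :: s)) e0 S mS _)).
  by move=> e /negPf ee0; rewrite /v inE ee0.
rewrite big_cons mulrDl expRD EFinM -muleA.
rewrite /v inE eqxx/= (negPf e0s).
by rewrite lee_wpmul2l// lee_fin expR_ge0.
Qed.

Lemma iid_laplace_maximal (t : R) : 0 <= t ->
  let A := \bigcap_(e in setT) [set om | (`|X e om| <= t)%R] in
  measurable A /\ ((1 - #|E|%:R * expR (- t / b))%:E <= P A)%E.
Proof.
move=> t0 A.
have mtail : measurable [set x : R | t < `|x|].
  by rewrite set_norm_gt -set_itvoy -set_itvNyo; exact: measurableU.
pose bad e := X e @^-1` [set x : R | t < `|x|].
have mbad e : measurable (bad e) by exact: measurable_preimageX.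
have AE : A = ~` (\bigcup_(e in setT) bad e).
  rewrite setC_bigcup; apply: eq_bigcapr => e _.
  apply/seteqP; split => om; rewrite /bad /= leNgt => /negP; exact.
have mU : measurable (\bigcup_(e in setT) bad e).
  by apply: fin_bigcup_measurable.
split; first by rewrite AE; exact: measurableC.
rewrite AE probability_setC// EFinB leeB//.
have : (P (\bigcup_(e in setT) bad e) <= \sum_(e \in [set: E]) P (bad e))%E.
  by apply: content_sub_fsum => //; exact: finite_finset.
move=> /le_trans; apply.
have -> : (\sum_(e \in [set: E]) P (bad e) = \sum_(e <- enum E) P (bad e))%E.
  have -> : [set: E] = [set` (xpredT : pred E)] by exact/seteqP.
  apply/esym; apply: bigfs; first exact: enum_uniq.
  by move=> e _; rewrite mem_enum.
rewrite big_enum/=; apply: (@le_trans _ _ (\sum_(e in E) (expR (- t / b))%:E)%E).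
  apply: lee_sum => e _; rewrite iid_laplace_marginal//.
  by apply: le_trans (laplace_law_tail b t b0 t0) _; rewrite (iid_laplace_law_setT e) mule1.
by rewrite sumEFin sumr_const mulr_natl.
Qed.

End iid.

(** * Privacy and accuracy of the mechanism *)

Theorem theorem5p5 (R : realType) (V E : finType) (ends : E -> V * V)
    (eps gamma : R) (heps : 0 < eps) (hgamma : 0 < gamma < 1)
    (sel : (E -> R) -> V -> V -> seq E) (hsel : min_path_selector ends sel)
    (d : measure_display) (Omega : measurableType d) (P : probability Omega R)
    (X : E -> Omega -> R) (hX : iid_laplace P eps^-1 X) :
  eps_DP P (mechanism sel eps gamma X) (output_events sel) eps /\
  forall w : E -> R, nonneg_weight w ->
    exists A : set Omega,
      [/\ measurable A,
          ((1 - gamma)%:E <= P A)%E &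
          forall om, A om ->
            forall (s t : V) (p : seq E), is_path ends s t p ->
              path_weight w ((mechanism sel eps gamma X w om).2 s t)
                <= path_weight w p + (2 * (size p)%:R / eps) * ln (#|E|%:R / gamma)].
Proof.
have b0 : 0 < eps^-1 by rewrite invr_gt0.
set c := eps^-1 * ln (#|E|%:R / gamma).
split.
  move=> w w' _ _ ww' S mS.
  (* The paths are a function of the noisy weights, so every output event is a Borel event on the
     noise translated by [v e + c]. *)
  have eventE v : [set om | S (mechanism sel eps gamma X v om)] =
      [set om | [set u | S (u, sel u)] (fun e => X e om + (v e + c))].
    apply/funext => om; rewrite /mechanism /=.
    suff -> : noisy_weights eps gamma (X^~ om) v = fun e => X e om + (v e + c) by [].
    by apply/funext => e; rewrite /noisy_weights addrA [w in w + _]addrC.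
  rewrite !eventE.
  apply: le_trans (iid_laplace_translate P eps^-1 X b0 hX (fun e => w' e + c) _ _ mS) _.
  rewrite lee_wpmul2r// lee_fin ler_expR invrK -[leRHS]mul1r ler_pM2r//.
  (* The offset [c] cancels in the difference, leaving the distance bounded by [neighboring]. *)
  by under eq_bigr do rewrite opprD addrACA subrr addr0.
move=> w _; case/andP: hgamma => gamma0 gamma1.
have c0 : 0 <= c.
  apply: mulr_ge0; first exact: ltW.
  (* Without edges the logarithm is taken at 0, where [ln] has the default value 0. *)
  have [->|E0] := posnP #|E|; first by rewrite mul0r ln0.
  apply: ln_ge0; rewrite ler_pdivlMr// mul1r (le_trans (ltW gamma1))//.
  by rewrite ler1n.
have [mA PA] := iid_laplace_maximal P eps^-1 X b0 hX c c0.
exists (\bigcap_(e in setT) [set om | `|X e om| <= c]); split => //.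
  apply: le_trans PA; rewrite lee_fin lerD2l lerN2 invrK mulNr.
  have [->|E0] := posnP #|E|; first by rewrite mul0r ltW.
  (* The choice of [c] makes [expR (- c * eps)] equal to [gamma / #|E|], so the union bound over the
     edges totals exactly [gamma]. *)
  rewrite /c mulrAC mulVf ?gt_eqF// mul1r expRN lnK ?posrE ?divr_gt0 ?ltr0n//.
  by rewrite invf_div mulrCA mulfV ?mulr1// pnatr_eq0 -lt0n.
move=> om Aom s t p pst; rewrite /mechanism /=.
set v := noisy_weights _ _ _ _.
(* The offset [c] shifts the noise range from [[-c, c]] to [[0, 2 * c]]. *)
have wv e : w e <= v e <= w e + 2 * c.
  have := Aom e I; rewrite /= ler_norml /v /noisy_weights -/c; lra.
have [_ /(_ p pst) min_sel] := hsel v s t (ex_intro _ p pst).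
apply: (@le_trans _ _ (path_weight v (sel v s t))).
  by apply: ler_sum => e _; case/andP: (wv e).
apply: (le_trans min_sel); apply: (@le_trans _ _ (\sum_(e <- p) (w e + 2 * c))).
  by apply: ler_sum => e _; case/andP: (wv e).
rewrite big_split/= lerD2l big_const_seq count_predT iter_addr_0 -mulr_natl /c.
by rewrite le_eqVlt; apply/orP; left; apply/eqP; ring.
Qed.
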